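(* $\beta'(c)=1-O\left(c^{-1/5}\right)$ as $c\to\infty$; that is, there is a constant $C$ such that $|1-\beta'(c)|\le C c^{-1/5}$ for all sufficiently large $c$.
   Context: For a graph $G$ and $p\in[0,1]$, $G_p$ denotes the random subgraph of $G$ obtained by deleting every edge of $G$ independently with probability $1-p$. An event depending on $k$ holds asymptotically almost surely (a.a.s.) if its probability tends to $1$ as $k\to\infty$. Let $\mathcal{G}$ be the set of all sequences $(G_k)_{k\geq 1}$ of simple graphs such that $G_k$ has minimum degree at least $k$. For a constant $c>0$ put $p=p(k)=c/k$ and define $$\beta'(c)=\inf_{(G_k)_{k\ge1}\in\mathcal{G}}\ \sup\{\beta\ge 0 : (G_k)_p \text{ contains a cycle of length at least } \beta k \text{ a.a.s.}\},$$ where the length of a cycle is its number of edges. *)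

(* Defs.v *)
From mathcomp Require Import all_boot all_order all_algebra.
From mathcomp Require Import all_classical all_reals all_analysis.

Set Implicit Arguments.
Unset Strict Implicit.
Unset Printing Implicit Defensive.

Import Order.TTheory GRing.Theory Num.Theory.
Import numFieldNormedType.Exports.

Local Open Scope classical_set_scope.
Local Open Scope ring_scope.

Record sgraph := SGraph {
  vertex : finType;
  edges : {set {set vertex}};
  card_edge : forall e : {set vertex}, e \in edges -> #|e| = 2%N }.

Definition degree (G : sgraph) (v : vertex G) : nat :=
  #|[set e in edges G | v \in e]%SET|.

(* The default value is never the minimum if G has a vertex, since degrees are
   smaller than the number of vertices; the graph without vertices gets minimum
   degree 0, hence it never has minimum degree at least k >= 1. *)
Definition min_degree (G : sgraph) : nat :=
  \big[minn/#|vertex G|]_(v : vertex G) degree v.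

(* A cycle is given by the list of its distinct vertices in cyclic order, so
   its number of edges is the size of the list. *)
Definition is_cycle (V : finType) (F : {set {set V}}) (s : seq V) : bool :=
  (3 <= size s)%N && ucycleb (fun u v => [set u; v]%SET \in F) s.

Section BetaPrime.
Context {R : realType}.

(* Probability that the edge set of the random subgraph G_p lies in A, the
   edges of G being kept independently with probability p. *)
Definition prob_subgraph (G : sgraph) (p : R) (A : set {set {set vertex G}})
    : R :=
  \sum_(F : {set {set vertex G}} | (F \subset edges G) && (F \in A))
    \prod_(e in edges G) (if e \in F then p else 1 - p).

Definition has_cycle_ge (V : finType) (l : R) : set {set {set V}} :=
  [set F | exists s : seq V, is_cycle F s /\ l <= (size s)%:R].

Definition edge_prob (c : R) (k : nat) : R := Num.min (c / k%:R) 1.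

Definition aas_cycle (c : R) (G : nat -> sgraph) (beta : R) : Prop :=
  (fun k : nat => prob_subgraph (edge_prob c k)
     (has_cycle_ge (V := vertex (G k)) (beta * k%:R))) @ \oo --> (1 : R).

Definition dense_seq (G : nat -> sgraph) : Prop :=
  forall k, (1 <= k)%N -> (k <= min_degree (G k))%N.

(* Extended-real valued: the set of admissible b may be unbounded above. If it
   is empty then its supremum is -oo. *)
Definition sup_cycle (c : R) (G : nat -> sgraph) : \bar R :=
  ereal_sup [set b%:E | b in [set b : R | 0 <= b /\ aas_cycle c G b]].

Definition beta' (c : R) : \bar R :=
  ereal_inf [set x | exists G : nat -> sgraph, dense_seq G /\ x = sup_cycle c G].

End BetaPrime.

(* Main.v *)
(* Following Riordan, explore G_p by depth-first search.
   Every positive answer reaches a new vertex, so (n being the number of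
   vertices) with high probability only O(n/p) = O(nk/c) edges are tested.  Each
   untested edge joins a vertex to one of its ancestors in the search forest and
   is still present independently with probability p.  Let q be about c^(1/5) and
   m about k/q.  If many untested edges join vertices at distance more than
   l = k - 10m, one of them is present and closes a long cycle.  Otherwise all but
   O(n/q^4) vertices have k - m short untested edges.  A vertex with at most m
   descendants cannot be among them; double counting then gives successively that
   all but O(n/q^3) vertices have descendants at distance 3k, that all but
   O(n/q^2) have fewer than l + m descendants within distance l, and that some
   downward path of length 3k meets fewer than m/2 exceptional vertices.  The
   other vertices of this path have m untested edges to ancestors at distance
   more than 6m, so with high probability every block of m consecutive vertices
   has such an edge in G_p, and these overlapping chords combine into a cycle of
   length at least k.  The complete graphs K_(k+1) give the upper bound. *)

Require Import Defs.
From mathcomp Require Import all_boot all_order all_algebra zify ring lra.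
Set Implicit Arguments.
Unset Strict Implicit.
Unset Printing Implicit Defensive.
Import Order.TTheory GRing.Theory Num.Theory.

(** * Cycles from overlapping chords *)

Section Chords.
Variables (adj : rel nat) (d : nat).
Hypothesis adjC : symmetric adj.
Hypothesis adjS : forall i, i < d -> adj i i.+1.

Lemma path_rev_iota a l : a + l <= d -> path adj (a + l) (rev (iota a l)).
Proof.
elim: l => [//|l IH] al; rewrite -addn1 iotaD rev_cat /= IH ?andbT; last lia.
by rewrite adjC (_ : a + (l + 1) = (a + l).+1) ?adjS //; lia.
Qed.

Lemma path_iota a l : a + l <= d -> path adj a (iota a.+1 l).
Proof.
elim: l a => [//|l IH] a al /=; rewrite adjS ?IH //; lia.
Qed.

(* [y' :: rcons t y] is a path whose interior lies below [y'].  It is closed by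
   descending from [y] to [y'], or extended by climbing from [y'] to a point just
   below [y] and jumping along the next chord; then it is traversed backwards. *)
Lemma chords_extend (m k y' y : nat) (t : seq nat) :
  0 < m ->
  (forall j, j * m < 2 * k ->
    exists x z, [/\ j * m <= x < j.+1 * m, x + 6 * m <= z <= d & adj x z]) ->
  path adj y' (rcons t y) -> uniq (y' :: rcons t y) ->
  (forall z, z \in y' :: t -> z <= y') -> y' + 4 * m <= y <= d ->
  y <= 2 * (size t + (y - y')) ->
  exists s, [/\ uniq s, all (fun i => i <= d) s, cycle adj s & k <= size s].
Proof.
move=> m0 chord.
have [f] := ubnP (2 * k - y); elim: f t y' y => // f IH t y' y yf pt ut tle yd yl.
(* Closing now gives a cycle on [size t + (y - y') + 1] vertices, which the last hypothesis makes
   larger than [y / 2 >= k]. *)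
case: (leqP (2 * k) y) => yk.
  exists (y' :: rcons t y ++ rev (iota y'.+1 (y - y').-1)).
  have mem z : z \in y' :: rcons t y -> z <= y' \/ z = y.
    rewrite -rcons_cons mem_rcons inE => /orP[/eqP->|/tle]; by [right|left].
  split.
  - rewrite -cat_cons cat_uniq ut rev_uniq iota_uniq andbT /=.
    apply/hasPn => z; rewrite mem_rev mem_iota => zi; apply/negP => /mem[]; lia.
  - rewrite -cat_cons all_cat; apply/andP; split; apply/allP => z.
      by move=> /mem[]; lia.
    rewrite mem_rev mem_iota; lia.
  - rewrite /= rcons_cat cat_path pt last_rcons /=.
    have -> : rcons (rev (iota y'.+1 (y - y').-1)) y' = rev (iota y' (y - y')).
      by rewrite -rev_cons [in RHS](_ : y - y' = (y - y').-1.+1) //; lia.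
    rewrite -[X in path _ X _](_ : y' + (y - y') = y) ?path_rev_iota //; lia.
  - rewrite /= size_cat size_rcons size_rev size_iota; lia.
have m1 : 0 < y %/ m by rewrite divn_gt0 //; lia.
(* The block just before that of [y] yields [y - 2 * m <= x < y], so its chord reaches some
   [z >= y + 4 * m]. *)
have [] := chord (y %/ m).-1.
  have := leq_trunc_div y m; nia.
move=> x [z [xm zd axz]].
have yx : x < y <= x + 2 * m.
  have := divn_eq y m; have := ltn_pmod y m0; nia.
have memy w : w \in y' :: rcons t y -> w <= y' \/ w = y.
  rewrite -rcons_cons mem_rcons inE => /orP[/eqP->|/tle]; by [right|left].
apply: (IH (rev t ++ iota y' (x - y').+1) y z).
- lia.
- rewrite -cats1 -catA cat_path /=.
  have : sorted adj (rev (y' :: rcons t y)).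
    by rewrite rev_sorted /=; apply: sub_path pt => u v; rewrite adjC.
  rewrite rev_cons rev_rcons /= -cats1 cat_path /= => /and3P[-> -> _] /=.
  rewrite cat_path path_iota /=; last lia.
  rewrite andbT.
  have -> : last y' (iota y'.+1 (x - y')) = x.
    rewrite (last_nth 0) size_iota -[_ :: _]/(iota y' (x - y').+1) nth_iota; lia.
  by [].
- have ut' : uniq (y' :: t) by move: ut; rewrite -rcons_cons rcons_uniq => /andP[].
  have yt : y \notin y' :: t by move: ut; rewrite -rcons_cons rcons_uniq => /andP[].
  have inlt w : w \in t -> w < y'.
    move=> wt; have := tle w; rewrite inE wt orbT => /(_ isT).
    by rewrite leq_eqVlt => /orP[/eqP wy|//]; move: ut'; rewrite /= -wy wt.
  have tn w : y' <= w -> w \notin t.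
    by move=> yw; apply/negP => /inlt; lia.
  have -> : uniq (y :: rcons (rev t ++ iota y' (x - y').+1) z) =
            uniq (z :: y :: rev t ++ iota y' (x - y').+1).
    by rewrite -rcons_cons rcons_uniq.
  rewrite !cons_uniq inE !mem_cat !mem_rev !mem_iota !negb_or !tn ?andbT; try lia.
  rewrite cat_uniq rev_uniq iota_uniq andbT; apply/and4P; split; try lia.
    by case/andP: ut'.
  apply/hasPn => w; rewrite mem_iota mem_rev => /andP[yw _]; exact: tn.
- move=> w; rewrite inE mem_cat mem_rev mem_iota => /or3P[/eqP->//|wt|].
    by have := tle w; rewrite inE wt orbT => /(_ isT); lia.
  lia.
- lia.
(* Leaving at [x] instead of [y] skips at most [2 * m] vertices; twice this loss is covered by
   [z - y >= 4 * m]. *)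
- rewrite size_cat size_rev size_iota; lia.
Qed.

Lemma overlapping_chords (m k : nat) :
  0 < m -> 0 < k ->
  (forall j, j * m < 2 * k ->
    exists x z, [/\ j * m <= x < j.+1 * m, x + 6 * m <= z <= d & adj x z]) ->
  exists s, [/\ uniq s, all (fun i => i <= d) s, cycle adj s & k <= size s].
Proof.
move=> m0 k0 chord; have [] := chord 0; first lia.
move=> x [z [xm zd axz]].
(* The chord of block 0 is the initial path: [x < m] and [z >= x + 6 * m] give
   [z <= 2 * (z - x)]. *)
apply: (@chords_extend m k x z [::]) => //=; rewrite ?inE ?axz //; try lia.
by move=> w; rewrite inE => /eqP->.
Qed.
End Chords.

(** * Search forests *)

Lemma double_count (S T : finType) (A : {set S}) (B : {set T}) (r : S -> T -> bool) a b :
  (forall x, x \in A -> a <= #|[set y in B | r x y]|) ->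
  (forall y, y \in B -> #|[set x in A | r x y]| <= b) ->
  #|A| * a <= #|B| * b.
Proof.
move=> Aa Bb; rewrite -!sum_nat_const.
apply: (@leq_trans (\sum_(x in A) #|[set y in B | r x y]|)); first exact: leq_sum.
apply: (@leq_trans (\sum_(y in B) #|[set x in A | r x y]|)); last exact: leq_sum.
rewrite leq_eqVlt; apply/orP; left; apply/eqP.
under eq_bigr do rewrite -sum1dep_card big_mkcondr /=.
under [RHS]eq_bigr do rewrite -sum1dep_card big_mkcondr /=.
exact: exchange_big.
Qed.

Section Forest.
Variables (V : finType) (ch : V -> seq V) (Y : {set {set V}}).

(* [ch v] is the path from [v] to the root of its tree, and [::] if [v] has not
   been reached. *)
Definition treeish := forall v x t, ch v = x :: t ->
  x = v /\ forall u t', t = u :: t' -> ch u = t /\ [set u; v] \in Y.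

Hypothesis tree : treeish.
Hypothesis total : forall v, ch v <> [::].

Definition dep v := size (ch v).

Lemma nth_ch v i : i < dep v -> ch (nth v (ch v) i) = drop i (ch v).
Proof.
elim: i => [|i IH] iv.
  by move: iv; rewrite drop0 /dep; case E: (ch v) => [//|x t] _ /=; have [{1}-> _] := tree E.
have := IH (ltnW iv); rewrite (drop_nth v (ltnW iv)) => /tree[_].
by rewrite (drop_nth v iv) => /(_ _ _ erefl)[].
Qed.

Lemma nth_ch_edge v i : i.+1 < dep v ->
  [set nth v (ch v) i; nth v (ch v) i.+1] \in Y.
Proof.
move=> iv; have := nth_ch (ltnW iv); rewrite (drop_nth v (ltnW iv)) => /tree[_].
by rewrite (drop_nth v iv) => /(_ _ _ erefl)[_]; rewrite finset.setUC.
Qed.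

Lemma mem_ch v : v \in ch v.
Proof.
by case E: (ch v) (total (v := v)) => [//|x t] _; have [-> _] := tree E; rewrite mem_head.
Qed.

Lemma dep_gt0 v : 0 < dep v. Proof. by rewrite /dep -has_predT; apply/hasP; exists v; rewrite ?mem_ch. Qed.

Lemma dep_nth v i : i < dep v -> dep (nth v (ch v) i) = dep v - i.
Proof. by move=> iv; rewrite /dep nth_ch // size_drop. Qed.

(** Depths strictly decrease along [ch v]. *)
Lemma uniq_ch v : uniq (ch v).
Proof.
apply/(uniqP v) => i j; rewrite !inE => iv jv E.
have {}iv : i < dep v := iv; have {}jv : j < dep v := jv.
by have := dep_nth iv; rewrite E dep_nth //; lia.
Qed.

Lemma index_ch (u v : V) : u \in ch v -> dep u <= dep v /\ index u (ch v) = dep v - dep u.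
Proof.
move=> uv; have iv : index u (ch v) < dep v by rewrite /dep index_mem.
by have := dep_nth iv; rewrite nth_index // => ->; lia.
Qed.

Lemma ch_drop (u v : V) : u \in ch v -> ch u = drop (dep v - dep u) (ch v).
Proof.
move=> uv; have [_ <-] := index_ch uv.
by rewrite -nth_ch ?nth_index // /dep index_mem.
Qed.

Lemma anc_nth (u v : V) : u \in ch v -> u = nth v (ch v) (dep v - dep u).
Proof. by move=> uv; have [_ <-] := index_ch uv; rewrite nth_index. Qed.

Lemma anc_trans (u v w : V) : u \in ch v -> v \in ch w -> u \in ch w.
Proof. by move=> uv /ch_drop E; apply: (@mem_drop (dep w - dep v)); rewrite -E. Qed.

Lemma anc_total (u v w : V) : u \in ch w -> v \in ch w -> dep u <= dep v -> u \in ch v.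
Proof.
move=> uw vw uv; rewrite (ch_drop vw).
have [uw' _] := index_ch uw; have [vw' _] := index_ch vw; have u0 := dep_gt0 u.
rewrite (anc_nth uw) (_ : _ - _ = (dep w - dep v) + (dep v - dep u)); last lia.
rewrite -nth_drop mem_nth // size_drop -/(dep w); lia.
Qed.

Lemma anc_eq (u v : V) : u \in ch v -> dep v <= dep u -> u = v.
Proof.
move=> uv vu; have E : dep v - dep u = 0 by lia.
by rewrite (anc_nth uv) E [RHS](anc_nth (mem_ch v)) subnn.
Qed.

Definition up v l := [set u | [&& u \in ch v, u != v & dep v <= dep u + l]].
Definition down v l := [set w | v \in up w l].
Definition desc v := [set w | (v \in ch w) && (v != w)].

Lemma card_up v l : #|up v l| <= l.
Proof.
(* The first [l + 1] entries of [ch v] include [v] itself, which [up] excludes. *)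
have : #|v |: up v l| <= l.+1.
  apply: leq_trans (subset_leq_card _) (leq_trans (card_size (take l.+1 (ch v))) _).
    apply/subsetP => u; rewrite !inE => /orP[/eqP->|/and3P[uv _ vu]].
      by rewrite (in_take _ (mem_ch v)) (index_ch (mem_ch v)).2 subnn.
    by rewrite (in_take _ uv) (index_ch uv).2; lia.
  by rewrite size_take; case: ifP => //; lia.
by rewrite cardsU1 inE eqxx andbF add1n.
Qed.

Definition tall v H := [exists w, (v \in ch w) && (dep w == dep v + H)].

(** A deeper [w] would have an ancestor at depth exactly [dep v + H], still below [v]. *)
Lemma tallPn (v : V) H w : ~~ tall v H -> v \in ch w -> dep w < dep v + H.
Proof.
move=> nt vw; rewrite ltnNge; apply/negP => le; case/negP: nt.
have [vw' _] := index_ch vw; have v0 := dep_gt0 v.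
have lt : dep w - (dep v + H) < dep w by lia.
apply/existsP; exists (nth w (ch w) (dep w - (dep v + H))).
have -> : dep (nth w (ch w) (dep w - (dep v + H))) = dep v + H.
  by rewrite dep_nth //; lia.
rewrite eqxx andbT (anc_total vw) //; first by rewrite mem_nth.
by rewrite dep_nth //; lia.
Qed.

Lemma card_segment w i l : i + l <= dep w -> #|[set x in take l (drop i (ch w))]| = l.
Proof.
move=> il; rewrite cardsE (card_uniqP _) ?take_uniq ?drop_uniq ?uniq_ch //.
by rewrite size_take size_drop -/(dep w); case: ifP => //; lia.
Qed.

Lemma mem_segment w i l (x : V) : i + l <= dep w ->
  (x \in take l (drop i (ch w))) = (x \in ch w) && (i <= dep w - dep x < i + l).
Proof.
move=> il; apply/idP/andP => [xs|[xw /andP[ix xl]]].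
  have xw : x \in ch w by apply: mem_drop (mem_take xs).
  split=> //.
  have xi : index x (take l (drop i (ch w))) < l.
    by apply: leq_trans (_ : _ < size (take l (drop i (ch w)))) _;
       rewrite ?index_mem // size_take size_drop; case: ifP => //; lia.
  have := nth_index w xs; rewrite nth_take // nth_drop => E.
  have := congr1 dep E; rewrite dep_nth; last lia.
  by have [? _] := index_ch xw; have := dep_gt0 x; lia.
rewrite (anc_nth xw) (_ : dep w - dep x = i + (dep w - dep x - i)); last lia.
rewrite -nth_drop -(@nth_take l) ?mem_nth //; last by lia.
by rewrite size_take size_drop -/(dep w); case: ifP; lia.
Qed.

Lemma tall_down v H l : tall v H -> l <= H -> l <= #|down v l|.
Proof.
move=> /existsP[w /andP[vw /eqP dw]] lH; have v0 := dep_gt0 v.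
(* Positions [H - l] to [H - 1] above [w] are the [l] vertices directly below [v]. *)
rewrite -[X in X <= _](@card_segment w (H - l) l); last by lia.
apply: subset_leq_card; apply/subsetP => x; rewrite !inE mem_segment; last lia.
move=> /andP[xw xd]; have [? _] := index_ch xw.
apply/and3P; split; last by lia.
- by apply: anc_total vw xw _; lia.
- by apply/eqP => vx; move: xd dw; rewrite -vx; lia.
Qed.

(** The pairs are counted from their lower end, above which there is only a path. *)
Lemma sum_down l : \sum_v #|down v l| <= #|V| * l.
Proof.
apply: leq_trans (_ : \sum_v #|up v l| <= _); last first.
  by rewrite -sum_nat_const; apply: leq_sum => v _; exact: card_up.
rewrite leq_eqVlt; apply/orP; left; apply/eqP.
under eq_bigr do rewrite -sum1dep_card big_mkcond /=.
under [RHS]eq_bigr do rewrite -sum1_card big_mkcond /=.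
exact: exchange_big.
Qed.

Lemma minimal_rich m v : m < #|desc v| ->
  exists r, [/\ v \in ch r, m < #|desc r| & forall w, w \in desc r -> #|desc w| <= m].
Proof.
have [f] := ubnP #|desc v|; elim: f v => // f IH v vf vm.
have [/existsP[w /andP[wv wm]]|/existsPn no] := boolP [exists w in desc v, m < #|desc w|].
  have [vw vw'] : v \in ch w /\ v != w by move: wv; rewrite inE => /andP[].
  have lt : #|desc w| < #|desc v|.
    apply: proper_card; apply/properP; split; last by exists w => //; rewrite inE eqxx andbF.
    apply/subsetP => x; rewrite !inE => /andP[wx wx']; rewrite (anc_trans vw wx).
    apply/eqP => E; move: wx; rewrite -E => wv'.
    have [le1 _] := index_ch vw; have [le2 _] := index_ch wv'.
    by move: vw'; rewrite (anc_eq vw) // eqxx.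
  have [|//|r [wr rm rmin]] := IH w; first by lia.
  by exists r; split => //; exact: anc_trans vw wr.
exists v; split=> [||w wv]; [exact: mem_ch|exact: vm|].
by move: (no w); rewrite wv /= -leqNgt.
Qed.

(* Positions on the path to the root are numbered from [v] upwards. *)
Lemma cycle_of_positions (F : {set {set V}}) v s :
  3 <= size s -> uniq s -> all (fun i => i < dep v) s ->
  cycle (fun i j => [set nth v (ch v) i; nth v (ch v) j] \in F) s ->
  is_cycle F (map (nth v (ch v)) s).
Proof.
move=> s3 us /allP sd cs; rewrite /is_cycle size_map s3 /ucycleb cycle_map cs /=.
by rewrite map_inj_in_uniq // => i j /sd iv /sd jv /eqP; rewrite nth_uniq ?uniq_ch // => /eqP.
Qed.

(** The edge closes the tree path from [v] up to [u], whose edges all lie in [Y]. *)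
Lemma cycle_of_long_edge (F : {set {set V}}) u v l : Y \subset F ->
  [set u; v] \in F -> u \in ch v -> dep u + l < dep v -> 1 <= l ->
  exists s, is_cycle F s /\ l <= size s.
Proof.
move=> YF uvF uv uvl l1.
exists (map (nth v (ch v)) (iota 0 (dep v - dep u).+1)); have u0 := dep_gt0 u.
split; last by rewrite size_map size_iota; lia.
apply: cycle_of_positions; rewrite ?size_iota ?iota_uniq //; first by lia.
  by apply/allP => i; rewrite mem_iota; lia.
rewrite /= rcons_path; apply/andP; split.
  apply: (@path_iota _ (dep v - dep u)) => // i id.
  by apply: (subsetP YF); apply: nth_ch_edge; lia.
rewrite (last_nth 0) size_iota -[0 :: _]/(iota 0 (dep v - dep u).+1) nth_iota // add0n.
by rewrite -(anc_nth uv) -[nth v _ 0](_ : v = _) // {1}(anc_nth (mem_ch v)) subnn.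
Qed.

End Forest.

(** * Untested edges that force a long cycle *)

(* [b], [low] and [ht] count the vertices with too few short untested edges, the
   ones without descendants at distance [3 * k], and the ones with too many
   descendants nearby. *)
Lemma few_exceptions n k m h q b low ht x t :
  m = 2 * h -> 0 < h -> q * m <= k -> k <= 2 * q * m -> 0 < n ->
  122 * 122 <= q -> b * m * q ^ 5 <= 14 * n * k ->
  low * m <= b * (3 * k + m) -> ht * m <= low * k -> x <= b + low + ht ->
  n <= t + low -> t * h <= x * (3 * k) -> False.
Proof.
move=> mh h0 qm k2 n0 q0 Hb Hlow Hht Hx Hn Ht.
have m0 : 0 < m by lia.
have qq : 0 < q by lia.
(* As [k <= 2 * q * m], every ratio [k / m] costs a factor of order [q]: [b], [low], [ht] and [t]
   come out of order [n / q ^ 4], [n / q ^ 3], [n / q ^ 2] and [n / q]. *)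
have b4 : b * q ^ 4 <= 28 * n.
  rewrite -(leq_pmul2r (_ : 0 < m * q)) ?muln_gt0 ?m0 //.
  have -> : b * q ^ 4 * (m * q) = b * m * q ^ 5 by rewrite (expnSr q 4); ring.
  by apply: leq_trans Hb _; apply: leq_trans (leq_mul (leqnn _) k2) _; nia.
have low3 : low <= 7 * q * b.
  rewrite -(leq_pmul2r m0); apply: leq_trans Hlow _; nia.
have ht2 : ht <= 2 * q * low.
  rewrite -(leq_pmul2r m0); apply: leq_trans Hht _; nia.
have tx : t <= 12 * q * x.
  rewrite -(leq_pmul2r h0); apply: leq_trans Ht _; nia.
have e4 : q ^ 4 = q * q * q * q by rewrite !expnS expn0; ring.
have l1 : low * (q * q * q) <= 196 * n by move: b4; rewrite e4; nia.
have h1 : ht * (q * q) <= 392 * n by nia.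
have b1 : b * (q * q) <= 28 * n.
  apply: leq_trans b4; rewrite e4; nia.
have l2 : low * (q * q) <= 196 * n by apply: leq_trans l1; nia.
have x1 : x * (q * q) <= 616 * n by nia.
have t1 : t * q <= 7392 * n by nia.
have l3 : low * q <= 196 * n by apply: leq_trans l2; nia.
(* Here [7588 = 12 * (28 + 196 + 392) + 196], which is below [122 * 122]. *)
have : n * q <= 7588 * n by nia.
nia.
Qed.

Lemma card_setU_le (T : finType) (A B : {set T}) : #|A :|: B| <= #|A| + #|B|.
Proof. exact: leq_card_setU. Qed.

Section Leaf.
Variables (V : finType) (ch : V -> seq V) (Y : {set {set V}}).
Hypothesis tree : treeish ch Y.
Hypothesis total : forall v, ch v <> [::].
Variables (E D : {set {set V}}).
Hypothesis E2 : forall e, e \in E -> #|e| = 2.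
Hypothesis D2 : forall e, e \in D -> #|e| = 2.
Hypothesis comparable : forall u v, [set u; v] \in E :\: D -> u \in ch v \/ v \in ch u.
Variables (k q h : nat).
Let m := 2 * h.
Let n := #|V|.
Hypothesis degE : forall v, k <= #|[set e in E | v \in e]|.
Hypothesis kn : k <= n.
Hypothesis D_le : #|D| * q ^ 5 <= 6 * n * k.
Hypothesis q0 : 122 * 122 <= q.
Hypothesis h0 : 0 < h.
Hypothesis qm : q * m <= k.
Hypothesis kqm : k <= 2 * q * m.

Local Notation dp := (dep ch).
Let l := k - 10 * m.
Let far := [set e in E :\: D |
  [exists u, [exists v, [&& e == [set u; v], u \in ch v & dp u + l < dp v]]]].
Let near := (E :\: D) :\: far.
Let nbr v := [set w | [set v; w] \in near].
Let notfull := [set v | #|nbr v| < k - m].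
Let H := 3 * k.
Let low := [set v | ~~ tall ch v H].
Let heavy := [set v | l + m <= #|down ch v l|].
Let bad := notfull :|: heavy.

Let m0 : 0 < m. Proof. by rewrite /m; lia. Qed.
Let km : 122 * 122 * m <= k. Proof. apply: leq_trans qm; rewrite leq_mul2r q0; lia. Qed.
Let n0 : 0 < n. Proof. by move: km m0; lia. Qed.

Let nbrP v w : w \in nbr v -> [\/ w \in up ch v l | w \in down ch v l].
Proof.
rewrite inE inE => /andP[nf vw].
have vnw : v != w.
  apply/eqP => vw'; have := E2 (e := [set v; w]); rewrite -vw' finset.setUid cards1.
  by move: vw; rewrite -vw' finset.setUid inE => /andP[_ ->] /(_ isT).
have notfar x y : [set x; y] = [set v; w] -> x \in ch y -> dp y <= dp x + l.
  move=> exy xy; rewrite leqNgt; apply: contra nf => lt.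
  rewrite inE vw /=; apply/existsP; exists x; apply/existsP; exists y.
  by rewrite exy eqxx xy lt.
case: (comparable vw) => [a|a]; [right|left].
  by rewrite !inE a vnw (notfar v w).
by rewrite !inE a eq_sym vnw (notfar w v) // finset.setUC.
Qed.

Let deg_nbr v : k <= #|[set e in D :|: far | v \in e]| + #|nbr v|.
Proof.
apply: leq_trans (degE v) _.
apply: (@leq_trans #|[set e in D :|: far | v \in e] :|: [set [set v; w] | w in nbr v]|).
  apply: subset_leq_card; apply/subsetP => e; rewrite !in_setU inE => /andP[eE ve].
  have [x [y [_ exy]]] : exists x y, x != y /\ e = [set x; y].
    by apply/cards2P; rewrite E2.
  have [w ew] : exists w, e = [set v; w].
    move: ve; rewrite exy in_set2 => /orP[/eqP->|/eqP->]; first by exists y.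
    by exists x; rewrite finset.setUC.
  rewrite inE ve andbT; apply/orP; case: (boolP (e \in D :|: far)) => [//|eDf]; first by left.
  right; apply/imsetP; exists w => //.
  rewrite inE -ew; move: eDf; rewrite in_setU negb_or => /andP[eD ef].
  by rewrite inE ef inE eD eE.
apply: leq_trans (leq_card_setU _ _) _; rewrite leq_add2l; exact: leq_imset_card.
Qed.

(** A vertex of [notfull] lies on at least [m] tested or far edges, and each edge has two ends;
    [14 = 2 * (6 + 1)]. *)
Let far_lt : #|far| * q ^ 5 < n * k -> #|notfull| * m * q ^ 5 <= 14 * n * k.
Proof.
move=> far_lt.
have : #|notfull| * m <= #|D :|: far| * 2.
  apply: (double_count (r := fun v (e : {set V}) => v \in e)) => [v|e].
    rewrite inE => vn; rewrite -(leq_add2r #|nbr v|); apply: leq_trans (deg_nbr v).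
    move: vn; set x := #|_|; move: x => x; lia.
  move=> eDf; have -> : 2 = #|e|.
    move: eDf; rewrite in_setU => /orP[/D2 //|]; rewrite inE => /andP[].
    by rewrite inE => /andP[_ /E2].
  by apply: subset_leq_card; apply/subsetP => v; rewrite inE => /andP[].
move=> le; apply: (@leq_trans (#|D :|: far| * 2 * q ^ 5)); first by rewrite leq_mul2r le orbT.
have := card_setU_le D far; move: (q ^ 5) far_lt D_le => Q; nia.
Qed.

(** Near neighbours are at most [l] ancestors and at most [m] descendants, and [l + m < k - m]. *)
Let poor_notfull v : #|desc ch v| <= m -> v \in notfull.
Proof.
move=> poor; rewrite inE.
have : #|nbr v| <= #|up ch v l :|: desc ch v|.
  apply: subset_leq_card; apply/subsetP => w /nbrP[wu|wd]; rewrite in_setU ?wu //.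
  by move: wd; rewrite !inE => /and3P[-> -> _]; rewrite orbT.
have := card_setU_le (up ch v l) (desc ch v); have := card_up tree total v l.
by rewrite /l; lia.
Qed.

(* Below a vertex with more than [m] descendants there is a lowest such vertex,
   all of whose descendants are exceptional. *)
Let card_low : #|low| * m <= #|notfull| * (H + m).
Proof.
(* The exceptional descendants found are within distance [H], the upper vertex being low, and each
   has at most [H] ancestors that close. *)
have : #|low :\: notfull| * m <= #|notfull| * H.
  apply: (double_count (r := fun v w => v \in up ch w H)) => [v|w wn].
    rewrite inE => /andP[vn]; rewrite inE => vt.
    have [|r [vr rm rmin]] := minimal_rich tree total (m := m) (v := v).
      by rewrite ltnNge; apply: contra vn; exact: poor_notfull.
    apply: leq_trans (ltnW rm) _; apply: subset_leq_card; apply/subsetP => w wr.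
    rewrite inE poor_notfull ?rmin //=.
    move: wr; rewrite inE => /andP[rw rw'].
    have vw := anc_trans tree vr rw.
    rewrite inE vw (ltnW (tallPn tree total vt vw)) andbT.
    apply/eqP => vw'; move: vr; rewrite vw' => wr.
    have [? _] := index_ch tree wr; have := anc_eq tree total rw.
    by move=> rweq; move: rw'; rewrite rweq ?eqxx.
  apply: leq_trans (card_up tree total w H).
  by apply: subset_leq_card; apply/subsetP => v; rewrite inE => /andP[].
have : #|low| <= #|low :\: notfull| + #|notfull|.
  by rewrite -(cardsID notfull low) addnC leq_add2l subset_leq_card // subsetIr.
nia.
Qed.

(** On average [down] has at most [l] elements. Tall vertices have at least [l], so the excess [m]
    at each heavy one must be paid for by low vertices, each giving at most [l <= k]. *)
Let card_heavy_tall : #|heavy :\: low| * m <= #|low| * k.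
Proof.
have H1 : \sum_(v in ~: low) (l + m * (v \in heavy)) <= \sum_v #|down ch v l|.
  rewrite [leqRHS](bigID (mem low)) /= -[leqLHS]add0n leq_add //.
  rewrite [leqLHS](eq_bigl (fun v => v \notin low)); last by move=> v; rewrite in_setC.
  apply: leq_sum => v; rewrite !inE negbK => vt.
  case: (leqP (l + m) #|down ch v l|) => [hv|_]; first by rewrite /= muln1.
  by rewrite /= muln0 addn0 (tall_down tree total vt) // /l /H; lia.
have H2 : \sum_(v in ~: low) (l + m * (v \in heavy)) = #|~: low| * l + #|heavy :\: low| * m.
  rewrite big_split /= sum_nat_const; congr addn.
  rewrite -big_distrr /= mulnC; congr muln.
  rewrite -sum1_card [RHS](eq_bigl (fun v => (v \in ~: low) && (v \in heavy))).
    by rewrite [RHS]big_mkcondr; apply: eq_bigr => v _; case: (v \in heavy).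
  by move=> v; rewrite in_setD in_setC.
have := sum_down tree total l; have := cardsC low; rewrite -/n.
have : l <= k by rewrite /l; lia.
by move: H1; rewrite H2; nia.
Qed.

Let card_tall : #|far| * q ^ 5 < n * k -> ~ (#|~: low| * h <= #|bad| * H).
Proof.
move=> /far_lt nfl; apply: (few_exceptions (m := m) (n := n) erefl h0 qm kqm n0 q0 nfl card_low card_heavy_tall).
  have := card_setU_le notfull heavy; rewrite -/bad.
  have : #|heavy| <= #|heavy :\: low| + #|low|.
    by rewrite -(cardsID low heavy) addnC leq_add2l subset_leq_card // subsetIr.
  lia.
by rewrite /n -(cardsC low) addnC.
Qed.

(** Choose for each tall vertex a descendant at distance [H]. A bad vertex lies on at most [H] of
    the chosen paths, so if all of them met [h] bad vertices, [card_tall] would fail. *)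
Let good_path : #|far| * q ^ 5 < n * k ->
  exists b, H < dp b /\ #|[set x in bad | x \in take H (ch b)]| < h.
Proof.
move=> farl; case: (boolP [exists b, (H < dp b) && (#|[set x in bad | x \in take H (ch b)]| < h)]).
  by case/existsP => b /andP[? ?]; exists b.
move=> /existsPn none; exfalso; apply: (card_tall farl).
(* The default value is never taken at a tall vertex. *)
pose b v := odflt v [pick w | (v \in ch w) && (dp w == dp v + H)].
have bP v : v \in ~: low -> v \in ch (b v) /\ dp (b v) = dp v + H.
  rewrite !inE negbK => /existsP[w vw]; rewrite /b; case: pickP => [w' /andP[? /eqP]//|no].
  by have := no w; rewrite vw.
apply: (double_count (r := fun v w => w \in take H (ch (b v)))) => [v vt|w _].
  have [vb db] := bP v vt; have := none (b v); rewrite negb_and -!leqNgt => /orP[|//].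
  have := dep_gt0 tree total v; rewrite db; lia.
apply: leq_trans (card_up tree total w H).
apply: subset_leq_card; apply/subsetP => v; rewrite inE => /andP[vt].
have [vb db] := bP v vt; have v0 := dep_gt0 tree total v.
rewrite -[ch (b v)]drop0 (mem_segment tree total) // -?/dp ?db; last lia.
move=> /andP[wb wd]; have [? _] := index_ch tree wb.
rewrite inE; apply/and3P; split; last by lia.
- by apply: (anc_total tree total vb wb); lia.
- by apply/eqP => vw; move: wd; rewrite -vw; lia.
Qed.

Let chords b j := [set e in E :\: D | [exists x, [exists y,
  [&& e == [set x; y], x \in take m (drop (j * m) (ch b)), y \in ch x & dp y + 6 * m < dp x]]]].

(** Of at least [k - m] short edges, fewer than [l + m = k - 9 * m] go down and at most [6 * m] go
    up by at most [6 * m] levels. This is what the slack [10 * m] in [l] is for. *)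
Let many_up_chords w : w \notin bad ->
  m <= #|[set u in nbr w | (u \in ch w) && (dp u + 6 * m < dp w)]|.
Proof.
rewrite in_setU negb_or !inE -!ltnNge => /andP[wf wh].
set C := [set u in _ | _].
have : #|nbr w| <= #|C :|: (down ch w l :|: up ch w (6 * m))|.
  apply: subset_leq_card; apply/subsetP => u uw; rewrite !in_setU.
  have [wu|->] := nbrP uw; last by rewrite orbT.
  rewrite inE uw /=; move: wu; rewrite [u \in up _ _ l]inE => /and3P[uw' unw _].
  rewrite uw' /=; case: ltnP => //= le.
  by rewrite [u \in up _ _ _]inE uw' unw le orbT.
have := card_setU_le C (down ch w l :|: up ch w (6 * m)).
have := card_setU_le (down ch w l) (up ch w (6 * m)).
have := card_up tree total w (6 * m).
by move: wf wh km m0; rewrite /l; lia.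
Qed.

(** Fewer than [h] of the [2 * h] vertices of the block are bad, and the others have [m] chords
    each, so [m * m <= 4 * #|chords b j|]; then [k <= 2 * q * m] and [16 <= q ^ 3] apply. *)
Let many_chords b j : H < dp b -> #|[set x in bad | x \in take H (ch b)]| < h ->
  j * m < 2 * k -> k * k <= #|chords b j| * q ^ 5.
Proof.
move=> Hb badb jk.
have jH : j * m + m <= H by rewrite /H; lia.
have seg : #|[set x in take m (drop (j * m) (ch b)) | x \notin bad]| >= h.
  have := card_segment tree (w := b) (i := j * m) (l := m); rewrite -(cardsID bad).
  have -> : [set x in take m (drop (j * m) (ch b))] :\: bad =
            [set x in take m (drop (j * m) (ch b)) | x \notin bad].
    by apply/setP => x; rewrite !inE andbC.
  have : #|[set x in take m (drop (j * m) (ch b))] :&: bad| <= #|[set x in bad | x \in take H (ch b)]|.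
    apply: subset_leq_card; apply/subsetP => x /setIP[xs xb]; apply/setIdP; split=> //.
    rewrite -[ch b]drop0 (mem_segment tree total) //; last by lia.
    by move: xs; rewrite inE (mem_segment tree total); [move=> /andP[-> ?]; lia|lia].
  move=> le /(_ (leq_trans jH (ltnW Hb))); move: le badb; rewrite /m; lia.
have : #|[set x in take m (drop (j * m) (ch b)) | x \notin bad]| * m <= #|chords b j| * 2.
  apply: (double_count (r := fun x (e : {set V}) => x \in e)) => [w|e].
    rewrite inE => /andP[ws wg]; apply: leq_trans (many_up_chords wg) _.
    rewrite -(card_in_imset (f := fun u => [set w; u])); last first.
      move=> u v _ _ /setP eq; have := eq v; have := eq u; rewrite !inE !eqxx !orbT.
      by move=> /esym/orP[/eqP->|/eqP->//] /orP[/eqP->|/eqP->].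
    apply: subset_leq_card; apply/subsetP => e /imsetP[u uC ->].
    move: uC; rewrite inE => /andP[un /andP[uw lt]].
    rewrite inE in_set2 eqxx andbT inE; apply/andP; split.
      by move: un; rewrite inE => /setDP[].
    by apply/existsP; exists w; apply/existsP; exists u; rewrite eqxx ws uw.
  rewrite inE => /andP[eR _]; have -> : 2 = #|e| by move: eR => /setDP[/E2].
  by apply: subset_leq_card; apply/subsetP => v; rewrite inE => /andP[].
move=> le.
have mm : m * m <= 4 * #|chords b j|.
  apply: (@leq_trans (2 * (#|[set x in take m (drop (j * m) (ch b)) | x \notin bad]| * m))).
    by rewrite mulnA leq_mul2r leq_mul2l seg !orbT.
  by move: le; lia.
have q16 : 16 <= q * q * q by apply: (@leq_trans (16 * 1 * 1)) => //; rewrite !leq_mul //; lia.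
have -> : q ^ 5 = q * q * q * (q * q) by rewrite !expnS expn0; ring.
apply: (leq_trans (leq_mul kqm kqm)).
have -> : 2 * q * m * (2 * q * m) = 4 * (m * m) * (q * q) by ring.
rewrite [leqRHS]mulnA leq_mul2r; apply/orP; right.
apply: (@leq_trans (#|chords b j| * 16)); first by move: mm; lia.
by rewrite leq_mul2l q16 orbT.
Qed.

(* The sets [Ss] depend only on the outcome of the search, whereas hitting all of
   them depends only on the untested edges. *)
Lemma robust_chords : exists Ss : seq {set {set V}},
  [/\ size Ss <= 4 * q,
      forall S, S \in Ss -> S \subset E :\: D /\ k * k <= #|S| * q ^ 5
    & forall F : {set {set V}}, Y \subset F -> (forall S, S \in Ss -> ~~ [disjoint F & S]) ->
        exists s : seq V, is_cycle F s /\ k <= size s + 10 * m].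
Proof.
have l1 : 3 <= l by rewrite /l; lia.
(* If far edges abound, a single one in [F] suffices and [far] is the only set to hit. *)
have [farl|farl] := leqP (n * k) (#|far| * q ^ 5).
  exists [:: far]; split=> [||F YF hit]; first by rewrite /=; lia.
    move=> S; rewrite inE => /eqP->; split; first by apply/subsetP => e; rewrite inE => /andP[].
    by apply: leq_trans farl; rewrite leq_mul2r kn orbT.
  have /pred0Pn[e /andP[/= eF]] := hit far (mem_head _ _).
  rewrite inE => /andP[_ /existsP[u /existsP[v /and3P[/eqP euv uv lt]]]].
  rewrite euv in eF.
  have [|s [cs sl]] := cycle_of_long_edge tree total YF eF uv lt; first by lia.
  by exists s; split=> //; move: sl; rewrite /l; lia.
have [b [Hb badb]] := good_path farl.
(* No block is missed: [j * m < 2 * k <= 4 * q * m] forces [j < 4 * q]. *)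
exists [seq chords b j | j <- iota 0 (4 * q) & j * m < 2 * k]; split.
- by rewrite size_map size_filter (leq_trans (count_size _ _)) // size_iota.
- move=> S /mapP[j]; rewrite mem_filter => /andP[jk _] ->; split.
    by apply/subsetP => e; rewrite inE => /andP[].
  exact: many_chords.
move=> F YF hit.
pose adj i j := [set nth b (ch b) i; nth b (ch b) j] \in F.
have [|i lt|||j jk|s [us ds cs ks]] := @overlapping_chords adj (dp b).-1 _ _ m k.
- by move=> i j; rewrite /adj finset.setUC.
- by apply: (subsetP YF); apply: (nth_ch_edge tree); lia.
- exact: m0.
- by move: km m0; lia.
- have /pred0Pn[e /andP[/= eF]] : ~~ [disjoint F & chords b j].
    apply/hit/mapP; exists j => //; rewrite mem_filter jk mem_iota /= add0n.
    rewrite -(ltn_pmul2r m0); apply: leq_trans jk _; nia.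
  rewrite inE => /andP[_ /existsP[x /existsP[y /and4P[/eqP exy xs yx lt]]]].
  move: xs; rewrite (mem_segment tree total) => [/andP[xb xd]|]; last by move: Hb; rewrite /H; lia.
  have yb := anc_trans tree yx xb.
  have [? _] := index_ch tree xb; have [? _] := index_ch tree yb; have y0 := dep_gt0 tree total y.
  exists (dp b - dp x), (dp b - dp y); split; try lia.
  by rewrite /adj -(anc_nth tree xb) -(anc_nth tree yb) -exy.
exists (map (nth b (ch b)) s); rewrite size_map; split; last exact: leq_trans ks (leq_addr _ _).
apply: (cycle_of_positions tree) => //; first by apply: leq_trans ks; move: km m0; lia.
by apply: sub_all ds => i /=; have := dep_gt0 tree total b; lia.
Qed.

End Leaf.

(** * Deferred decisions *)

Section ConditionalProb.
Local Open Scope ring_scope.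
Variables (R : realFieldType) (T : finType) (E : {set T}) (p : R).
Hypothesis p01 : 0 <= p <= 1.
Implicit Types (D Y S F : {set T}) (A : pred {set T}).

(* Probability of [A] given that the edges kept among those of [D] are
   exactly the ones of [Y]. *)
Definition cond_prob (D Y : {set T}) (A : pred {set T}) : R :=
  \sum_(F : {set T} | [&& F \subset E, F :&: D == Y & A F])
    \prod_(e in E :\: D) (if e \in F then p else 1 - p).

(** This is one query: the sum is split by whether [e] is in [F], and the factor of [e] comes out of
    the product. *)
Lemma cond_prob_split D Y A e : Y \subset D -> e \in E -> e \notin D ->
  cond_prob D Y A = p * cond_prob (e |: D) (e |: Y) A + (1 - p) * cond_prob (e |: D) Y A.
Proof.
move=> YD eE eD; have eY : e \notin Y by apply: contra eD; exact: (subsetP YD).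
have prodE F : \prod_(x in E :\: D) (if x \in F then p else 1 - p) =
    (if e \in F then p else 1 - p) * \prod_(x in E :\: (e |: D)) (if x \in F then p else 1 - p).
  rewrite (bigD1 e) ?inE ?eD //=; congr (_ * _); apply: eq_bigl => x.
  by rewrite !inE; case: (x == e); rewrite ?andbT ?andbF.
rewrite /cond_prob (bigID (fun F : {set T} => e \in F)) /= !big_distrr /=; congr (_ + _).
  rewrite (eq_bigl (fun F : {set T} => [&& F \subset E, F :&: (e |: D) == e |: Y & A F])).
    apply: eq_bigr => F /and3P[_ /eqP FD _]; rewrite prodE.
    by have : e \in F :&: (e |: D); [rewrite FD setU11|rewrite inE => /andP[-> _]].
  move=> F; suff -> : (F :&: (e |: D) == e |: Y) = (e \in F) && (F :&: D == Y).
    by case: (F \subset E); case: (e \in F); case: (_ == _); case: (A F).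
  apply/eqP/andP => [FD|[eF /eqP <-]]; last first.
    by apply/setP => x; rewrite !inE; case: eqP => [->|]; rewrite ?eF.
  have eF : e \in F by have := setU11 e Y; rewrite -FD inE => /andP[].
  split=> //; apply/eqP/setP => x; have /setP/(_ x) := FD; rewrite !inE.
  by case: eqP => [->|//]; rewrite (negbTE eD) (negbTE eY) andbF.
rewrite (eq_bigl (fun F : {set T} => [&& F \subset E, F :&: (e |: D) == Y & A F])).
  apply: eq_bigr => F /and3P[_ /eqP FD _]; rewrite prodE; case: ifP => // eF.
  by move: eY; rewrite -FD !inE eF eqxx.
move=> F; suff -> : (F :&: (e |: D) == Y) = (e \notin F) && (F :&: D == Y).
  by case: (F \subset E); case: (e \in F); case: (_ == _); case: (A F).
apply/eqP/andP => [FD|[eF /eqP <-]]; last first.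
  by apply/setP => x; rewrite !inE; case: eqP => [->|]; rewrite ?(negbTE eF).
have eF : e \notin F by move: eY; rewrite -FD !inE eqxx andbT.
split=> //; apply/eqP/setP => x; have /setP/(_ x) := FD; rewrite !inE.
by case: eqP => [->|//]; rewrite (negbTE eD) (negbTE eY) andbF.
Qed.

Lemma cond_prob_setT D Y : Y \subset D -> D \subset E -> cond_prob D Y predT = 1.
Proof.
have [f] := ubnP #|E :\: D|; elim: f D Y => // f IH D Y lf YD DE.
have [ED0|[e]] := set_0Vmem (E :\: D).
  have {}ED : D = E by apply/eqP; rewrite eqEsubset DE -setD_eq0 ED0 eqxx.
  rewrite /cond_prob ED0 (big_pred1 Y) => [|F]; first by rewrite big_set0.
  rewrite andbT ED; apply/andP/eqP => [[/setIidPl -> /eqP//]|->].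
  by rewrite -ED YD; split=> //; apply/eqP/setIidPl; rewrite ED -ED.
rewrite inE => /andP[eD eE].
have lt : (#|E :\: (e |: D)| < f)%N.
  move: lf; rewrite ltnS; apply: leq_trans; apply: proper_card; apply/properP; split.
    by apply/subsetP => x; rewrite !inE negb_or => /andP[/andP[_ ->] ->].
  by exists e; rewrite !inE ?eqxx // eD.
have eDE : e |: D \subset E by rewrite subUset sub1set eE.
rewrite (cond_prob_split _ YD eE eD) !IH ?setUS //; first by rewrite !mulr1 addrC subrK.
exact: subset_trans YD (subsetUr _ _).
Qed.

Lemma cond_prob_le D Y (A B : pred {set T}) :
  (forall F : {set T}, Y \subset F -> A F -> B F) -> cond_prob D Y A <= cond_prob D Y B.
Proof.
move=> AB; rewrite /cond_prob big_mkcond [leRHS]big_mkcond; apply: ler_sum => F _.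
have w0 : 0 <= \prod_(e in E :\: D) (if e \in F then p else 1 - p).
  by apply: prodr_ge0 => e _; case: ifP => _; move: p01 => /andP[? ?]; lra.
case: ifP => [/and3P[-> FD AF]|_]; last by case: ifP.
have YF : Y \subset F by rewrite -(eqP FD) subsetIl.
by rewrite FD (AB _ YF AF) /=.
Qed.

(** The edges of [S] are revealed one by one; a present edge contributes 0, an absent one the factor
    [1 - p]. *)
Lemma cond_prob_disjoint D Y S : Y \subset D -> D \subset E -> S \subset E :\: D ->
  cond_prob D Y (fun F => [disjoint F & S]) = (1 - p) ^+ #|S|.
Proof.
have [f] := ubnP #|S|; elim: f D Y S => // f IH D Y S lf YD DE SD.
have [S0|[e eS]] := set_0Vmem S.
  rewrite S0 cards0 expr0 -(cond_prob_setT YD DE); apply: eq_bigl => F.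
  by rewrite disjoint_sym disjoints_subset sub0set.
have /setDP[eE eD] := subsetP SD e eS.
have eY : e \notin Y by apply: contra eD; exact: (subsetP YD).
rewrite (cond_prob_split _ YD eE eD) (_ : cond_prob _ (e |: Y) _ = 0) ?mulr0 ?add0r; last first.
  apply: big_pred0 => F; apply/negP => /and3P[_ /eqP FD /pred0P/(_ e)/=].
  have : e \in F :&: (e |: D) by rewrite FD setU11.
  by rewrite inE => /andP[-> _]; rewrite eS.
have -> : cond_prob (e |: D) Y (fun F => [disjoint F & S]) =
          cond_prob (e |: D) Y (fun F => [disjoint F & S :\ e]).
  apply: eq_bigl => F; congr (_ && _); case: eqP => //= FD.
  have eF : e \notin F by move: eY; rewrite -FD !inE eqxx andbT.
  apply/idP/idP; first by apply: disjointWr; exact: subD1set.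
  rewrite -[in X in _ -> X](setD1K eS) => /pred0P d; apply/pred0P => x /=.
  have := d x; rewrite /= !inE; case: eqP => [->|_] //=; by rewrite (negbTE eF).
rewrite IH.
- by rewrite [in RHS](cardsD1 e) eS exprS.
- by move: lf; rewrite (cardsD1 e) eS.
- exact: subset_trans YD (subsetUr _ _).
- by rewrite subUset sub1set eE.
- apply/subsetP => x; rewrite !inE => /andP[xe /(subsetP SD)].
  by rewrite !inE negb_or xe.
Qed.

Lemma cond_prob_union (Ss : seq {set T}) D Y (del : R) : Y \subset D -> D \subset E ->
  (forall S, S \in Ss -> S \subset E :\: D /\ (1 - p) ^+ #|S| <= del) ->
  cond_prob D Y (fun F => has (fun S : {set T} => [disjoint F & S]) Ss) <= (size Ss)%:R * del.
Proof.
move=> YD DE; elim: Ss => [_|S Ss IH SsP].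
  by rewrite mul0r /cond_prob big1 // => F /and3P[].
have [SD Sd] := SsP S (mem_head _ _).
apply: (@le_trans _ _ (cond_prob D Y (fun F => [disjoint F & S]) +
  cond_prob D Y (fun F => has (fun S : {set T} => [disjoint F & S]) Ss))).
  rewrite /cond_prob big_mkcond [X in _ <= X + _]big_mkcond [X in _ <= _ + X]big_mkcond -big_split.
  apply: ler_sum => F _ /=.
  have w0 : 0 <= \prod_(e in E :\: D) (if e \in F then p else 1 - p).
    by apply: prodr_ge0 => e _; case: ifP => _; move: p01 => /andP[? ?]; lra.
  by case: (F \subset E); case: (F :&: D == Y); case: [disjoint F & S];
     case: (has _ _) => //=; lra.
rewrite /= -addn1 addnC natrD mulrDl mul1r cond_prob_disjoint //; apply: lerD => //.
by apply: IH => S' S's; apply: SsP; rewrite inE S's orbT.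
Qed.

End ConditionalProb.

(** * Depth-first search *)

Section DFS.
Variables (V : finType) (E : {set {set V}}).
Implicit Types (D Y : {set {set V}}) (ch : V -> seq V) (st : seq V).

(* [D] are the tested edges, [Y] those found to be present, [st] is the stack and
   [ch v] the stack at the time when [v] was pushed. *)
Record dfs_state D Y st ch : Prop := DfsState {
  dfs_testedE : D \subset E;
  dfs_keptD : Y \subset D;
  dfs_tree : treeish ch Y;
  dfs_stack : forall v t, st = v :: t -> ch v = st;
  dfs_card : #|Y| <= #|[set v | ch v != [::]]|;
  dfs_comparable : forall u v, [set u; v] \in E :\: D ->
    ch u <> [::] -> ch v <> [::] -> u \in ch v \/ v \in ch u;
  dfs_finished : forall u v, ch u <> [::] -> ch v = [::] -> u \notin st ->
    [set u; v] \notin E :\: D }.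

(** This serves both for a new root, where the stack is empty and the sets do not change, and for a
    positive answer. *)
Lemma dfs_push D Y st ch D' Y' u : dfs_state D Y st ch -> ch u = [::] ->
  D \subset D' -> D' \subset E -> Y \subset Y' -> Y' \subset D' -> #|Y'| <= #|Y|.+1 ->
  (forall v t, st = v :: t -> [set v; u] \in Y') ->
  dfs_state D' Y' (u :: st) (fun w => if w == u then u :: st else ch w).
Proof.
move=> [DE YD tree stack cY comp fin] chu DD' D'E YY' Y'D' cY' edge.
have EDD' e : e \in E :\: D' -> e \in E :\: D.
  by rewrite !inE => /andP[eD' ->]; rewrite andbT; apply: contra eD'; exact: (subsetP DD').
split=> //.
- move=> w x t; case: eqP => [-> [<- <-]|_ chw].
    split=> // v t' stv; have chv := stack _ _ stv.
    case: eqP => [vu|_]; last by split=> //; apply: edge stv.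
    by rewrite vu chu stv in chv.
  have [-> H] := tree _ _ _ chw; split=> // v t' tv; have [chv vwY] := H _ _ tv.
  case: eqP => [vu|_]; last by split=> //; apply: (subsetP YY').
  by rewrite vu chu tv in chv.
- by move=> v t [<- _]; rewrite eqxx.
- apply: leq_trans cY' _; apply: leq_ltn_trans cY _; apply: proper_card; apply/properP; split.
    by apply/subsetP => w; rewrite !inE; case: (w == u).
  by exists u; rewrite !inE ?eqxx // chu eqxx.
(* Vertices already popped have no untested edge to the unreached [u], so its untested edges to
   reached vertices end on the stack, that is, at its ancestors. *)
- have main v : v != u -> ch v <> [::] -> [set u; v] \in E :\: D -> v \in u :: st.
    move=> vu chv uvE; rewrite inE (negbTE vu) /=; apply: contraLR uvE => vst.
    by rewrite finset.setUC; exact: fin.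
  move=> v w; have [->|vu] := eqVneq v u; have [->|wu] := eqVneq w u; move=> vwE.
  + by rewrite mem_head; left.
  + by move=> _ chw; right; apply: main wu chw (EDD' _ vwE).
  + by move=> chv _; left; apply: main => //; rewrite finset.setUC; exact: EDD'.
  + exact: comp (EDD' _ vwE).
- move=> v w; case: eqP => [->|vu]; first by rewrite mem_head.
  case: eqP => // _ chv chw; rewrite inE negb_or => /andP[_ vst].
  by apply: contra (fin v w chv chw vst); exact: EDD'.
Qed.

Lemma dfs_pop D Y v st ch : dfs_state D Y (v :: st) ch ->
  (forall u, ch u = [::] -> [set v; u] \notin E :\: D) -> dfs_state D Y st ch.
Proof.
move=> [DE YD tree stack cY comp fin] no; split=> //.
  by move=> u t stu; have [_ /(_ _ _ stu)[]] := tree _ _ _ (stack _ _ erefl).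
move=> u w chu chw ust; have [->|uv] := eqVneq u v; first exact: no.
by apply: fin => //; rewrite inE negb_or uv.
Qed.

Lemma dfs_test D Y st ch e : dfs_state D Y st ch -> e \in E -> dfs_state (e |: D) Y st ch.
Proof.
move=> [DE YD tree stack cY comp fin] eE.
have EDD' x : x \in E :\: (e |: D) -> x \in E :\: D.
  by rewrite !inE negb_or => /andP[/andP[_ ->] ->].
split=> //.
- by rewrite subUset sub1set eE.
- exact: subset_trans YD (subsetUr _ _).
- by move=> u v /EDD'; exact: comp.
- by move=> u v chu chv ust; apply: contra (fin u v chu chv ust); exact: EDD'.
Qed.

Section Potential.
Local Open Scope ring_scope.
Variables (R : realFieldType) (p a b f K : R) (A : pred {set {set V}}).
Hypothesis p01 : 0 <= p <= 1.
Hypothesis fair : a * (p * b + (1 - p)) = 1.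

(** A Chernoff bound in potential form: [f] is meant for the failure after a short search, the other
    term for the event of too many queries. *)
Let Phi D Y : R := f + K * (a ^+ #|D| * b ^+ #|Y|).

Hypothesis final : forall D Y ch, D \subset E -> Y \subset D -> treeish ch Y ->
  (forall v, ch v <> [::]) ->
  (forall u v, [set u; v] \in E :\: D -> u \in ch v \/ v \in ch u) ->
  (#|Y| <= #|V|)%N -> cond_prob E p D Y A <= Phi D Y.

(* [a ^+ #|D| * b ^+ #|Y|] is a martingale under the queries of the search. *)
Lemma dfs_prob D Y st ch : dfs_state D Y st ch -> cond_prob E p D Y A <= Phi D Y.
Proof.
(* The weight 2 makes a push decrease the measure although the stack grows. *)
have [g] := ubnP (#|E :\: D| + 2 * #|[set v | ch v == [::]]| + size st).
elim: g D Y st ch => // g IH D Y st ch lg S.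
have [DE YD tree stack cY comp fin] := S.
have push_lt u t : ch u = [::] ->
    (#|[set w | (if w == u then u :: t else ch w) == [::]]| < #|[set v | ch v == [::]]|)%N.
  move=> chu; apply: proper_card; apply/properP; split.
    by apply/subsetP => w; rewrite !inE; case: ifP.
  by exists u; rewrite !inE ?eqxx ?chu.
case: st S lg stack fin => [|v st] S lg stack fin.
  have [no|[u]] := set_0Vmem [set v | ch v == [::]].
    have total v : ch v <> [::].
      by move=> chv; have : v \in [set v | ch v == [::]] by [rewrite inE chv]; rewrite no inE.
    apply: (final DE YD tree total) => [u v uv|]; first exact: comp.
    exact: leq_trans cY (max_card _).
  rewrite inE => /eqP chu.
  apply: (IH _ _ [:: u] (fun w => if w == u then [:: u] else ch w)).
    have := push_lt u [::] chu; move: lg => /=; lia.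
  by apply: (dfs_push S chu).
have [/existsP[u /andP[/eqP chu vu]]|/existsPn no] :=
    boolP [exists u, (ch u == [::]) && ([set v; u] \in E :\: D)]; last first.
  apply: (IH _ _ st ch); first by move: lg => /=; lia.
  by apply: dfs_pop S _ => u chu; have := no u; rewrite chu eqxx.
have /setDP[eE eD] := vu.
have eY : [set v; u] \notin Y by apply: contra eD; exact: (subsetP YD).
have ED_lt : (#|E :\: ([set v; u] |: D)| < #|E :\: D|)%N.
  apply: proper_card; apply/properP; split; last by exists [set v; u]; rewrite // !inE eqxx.
  by apply/subsetP => x; rewrite !inE negb_or => /andP[/andP[_ ->] ->].
have yes : cond_prob E p ([set v; u] |: D) ([set v; u] |: Y) A <=
           Phi ([set v; u] |: D) ([set v; u] |: Y).
  apply: (IH _ _ (u :: v :: st) (fun w => if w == u then u :: v :: st else ch w)).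
    by have := push_lt u (v :: st) chu; move: lg ED_lt => /=; lia.
  apply: (dfs_push S chu); rewrite ?subsetUr ?setUS ?cardsU1 ?eY //.
    by rewrite subUset sub1set eE.
  by move=> w t [<- _]; rewrite setU11.
have no : cond_prob E p ([set v; u] |: D) Y A <= Phi ([set v; u] |: D) Y.
  by apply: (IH _ _ (v :: st) ch); [rewrite -ltnS; apply: leq_ltn_trans lg; rewrite -!addSn !leq_add2r|exact: dfs_test].
rewrite (cond_prob_split p A YD eE eD).
have /andP[p0 p1] := p01.
have q0 : 0 <= 1 - p by lra.
apply: le_trans (lerD (ler_wpM2l p0 yes) (ler_wpM2l q0 no)) _.
rewrite /Phi !cardsU1 eD eY !exprS; move: (a ^+ #|D|) (b ^+ #|Y|) => x y.
rewrite le_eqVlt; apply/orP; left; apply/eqP.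
transitivity (f + K * (a * (p * b + (1 - p)) * (x * y))); first by ring.
by rewrite fair mul1r.
Qed.

Lemma dfs_prob0 : cond_prob E p set0 set0 A <= f + K.
Proof.
have -> : f + K = Phi set0 set0 by rewrite /Phi !cards0 !expr0 !mulr1.
apply: (@dfs_prob _ _ [::] (fun=> [::])); split; rewrite ?sub0set ?cards0 //.
Qed.
End Potential.
End DFS.

From mathcomp Require Import all_classical all_reals all_analysis.
Import numFieldNormedType.Exports.
Local Open Scope classical_set_scope.
Local Open Scope ring_scope.

(** * Asymptotics *)

Lemma bigminn_le (I : eqType) (s : seq I) (F : I -> nat) (d : nat) :
  (\big[minn/d]_(i <- s) F i <= d)%N /\
  forall i, i \in s -> (\big[minn/d]_(i <- s) F i <= F i)%N.
Proof.
elim: s => [|x s [IHd IHF]]; first by rewrite big_nil.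
rewrite big_cons; split=> [|i]; first by rewrite geq_min IHd orbT.
by rewrite inE geq_min => /orP[/eqP->|/IHF->]; rewrite ?leqnn ?orbT.
Qed.

Lemma min_degree_card (G : sgraph) : (min_degree G <= #|vertex G|)%N.
Proof. exact: (bigminn_le _ _ _).1. Qed.

Lemma min_degree_le (G : sgraph) (v : vertex G) : (min_degree G <= degree v)%N.
Proof. by apply: (bigminn_le _ _ _).2; rewrite mem_index_enum. Qed.

(** Rounding down a quotient that is at least 1 loses at most a factor 2. The even number
    [m = 2 * h] lets half a block be [h]. *)
Lemma double_scale (k q : nat) : (0 < q)%N -> (2 * q <= k)%N ->
  exists h, [/\ 0 < h, q * (2 * h) <= k & k <= 2 * q * (2 * h)]%N.
Proof.
move=> q0 qk; exists (k %/ (2 * q))%N.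
have h0 : (0 < k %/ (2 * q))%N by rewrite divn_gt0; lia.
by have := divn_eq k (2 * q); have := @ltn_pmod k (2 * q); split; nia.
Qed.

(** With [Q <= c], a group of [t] queries has [t * p >= 2]; too long a search contains [2 * n] such
    groups, as [t * Q <= 3 * k]. *)
Lemma query_budget (n k Q d : nat) : (0 < Q)%N -> (Q <= k)%N -> (6 * n * k < d * Q)%N ->
  exists t, (2 * k <= t * Q)%N /\ (t * (2 * n) <= d)%N.
Proof.
move=> Q0 Qk lt; exists (2 * k %/ Q).+1; set t := (_ %/ _)%N.
have := leq_trunc_div (2 * k) Q; have := ltn_ceil (2 * k) Q0; rewrite -/t => t2 t1.
split; first by nia.
rewrite -(leq_pmul2r Q0); apply: leq_trans (ltnW lt); nia.
Qed.

(** * Failure probability for a single graph *)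

Section LongCycle.
Variable R : realType.

(** A rational substitute for the exponential bound on missing [N] edges; with [N * p >= k] it gives
    [1 / k]. *)
Lemma expr1B_le (p : R) (N : nat) : 0 <= p <= 1 -> (1 - p) ^+ N * (1 + N%:R * p) <= 1.
Proof.
move=> /andP[p0 p1]; elim: N => [|N IH]; first by rewrite expr0 mul0r addr0 mul1r.
apply: le_trans IH; rewrite exprSr -mulrA ler_wpM2l ?exprn_ge0 //; first by lra.
rewrite -natr1; have : 0 <= N%:R * p by rewrite mulr_ge0.
by move: (N%:R : R) => x; nra.
Qed.

Lemma prob_subgraphE (G : sgraph) (p : R) (A : set {set {set vertex G}}) :
  prob_subgraph p A = cond_prob (edges G) p finset.set0 finset.set0 (mem A).
Proof.
rewrite /prob_subgraph /cond_prob; apply: eq_big => F.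
  by rewrite finset.setI0 eqxx.
by move=> _; apply: eq_bigl => e; rewrite finset.setD0.
Qed.

Lemma prob_subgraph_compl (G : sgraph) (p : R) (A : set {set {set vertex G}}) :
  0 <= p <= 1 ->
  `|1 - prob_subgraph p A| = cond_prob (edges G) p finset.set0 finset.set0 (fun F => F \notin A).
Proof.
move=> p01; have <- := cond_prob_setT p (finset.sub0set finset.set0) (finset.sub0set (edges G)).
rewrite prob_subgraphE {1 2}/cond_prob.
rewrite (bigID (mem A)) /= addrC.
have -> : forall x y z : R, y = z -> x + y - z = x by move=> x y z ->; rewrite addrK.
  rewrite ger0_norm; first by apply: eq_bigl => F; rewrite andbT andbA.
  apply: sumr_ge0 => F _; apply: prodr_ge0 => e _; case: ifP => _; move: p01 => /andP[? ?]; lra.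
by apply: eq_bigl => F; rewrite andbT andbA.
Qed.

Lemma long_cycle_prob (G : sgraph) (k q : nat) (c : R) :
  (122 * 122 <= q)%N -> (q ^ 5 <= k)%N -> (q ^ 5)%:R <= c -> c <= k%:R ->
  (k <= min_degree G)%N ->
  cond_prob (edges G) (c / k%:R) finset.set0 finset.set0
    (fun F => F \notin has_cycle_ge (V := vertex G) ((1 - 10 / q%:R) * k%:R : R))
  <= (4 * q).+1%:R / k%:R.
Proof.
move=> q0 qk qc ck kd.
have q1 : (0 < q)%N by apply: leq_trans q0.
have q50 : (0 < q ^ 5)%N by rewrite expn_gt0 q1.
have k0 : (0 < k)%N := leq_trans q50 qk.
have q2k : (2 * q <= k)%N.
  apply: leq_trans qk; rewrite expnSr leq_mul2r; apply/orP; right.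
  by apply: (@leq_trans (q ^ 1)); [apply: leq_trans q0|rewrite leq_exp2l //; apply: leq_trans q0].
have k0R : 0 < k%:R :> R by rewrite ltr0n.
have q0R : 0 < q%:R :> R by rewrite ltr0n.
set p := c / k%:R.
have p01 : 0 <= p <= 1.
  by rewrite /p ler_pdivrMr // mul1r ck andbT divr_ge0 // ?ler0n // (le_trans _ qc) ?ler0n.
have /andP[p0 p1] := p01.
set n := #|vertex G|.
have kn : (k <= n)%N by apply: leq_trans kd (min_degree_card G).
pose a : R := (1 - p / 2)^-1.
have p2 : 0 < 1 - p / 2 by lra.
have fair : a * (p * 2^-1 + (1 - p)) = 1 by rewrite /a; field; lra.
(* The potential has [f = 4 * q / k], [K = 2 ^ (-n)] and [b = 1 / 2], and [2 ^ (-n) <= 1 / k] since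
   [k <= n]. *)
apply: (@le_trans _ _ ((4 * q)%:R * k%:R^-1 + 2^-1 ^+ n)); last first.
  rewrite -[(4 * q).+1%:R]natr1 mulrDl lerD2l mul1r exprVn lef_pV2 ?posrE ?exprn_gt0 //.
  by rewrite -natrX ler_nat; apply: leq_trans kn (ltnW (ltn_expl n _)).
apply: (dfs_prob0 p01 fair) => D Y ch DE YD tree total comp Yn.
have a0 : 0 < a by rewrite invr_gt0.
have [Dsmall|Dlarge] := leqP (#|D| * q ^ 5) (6 * n * k).
  apply: (@le_trans _ _ ((4 * q)%:R * k%:R^-1)); last first.
    by rewrite lerDl !mulr_ge0 ?exprn_ge0 // ltW.
  have [h [h0 hk kh]] := double_scale q1 q2k.
  have E2 e : e \in edges G -> #|e| = 2%N by exact: card_edge.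
  have D2 e : e \in D -> #|e| = 2%N by move=> /(fintype.subsetP DE)/E2.
  have degE v : (k <= #|[set e in edges G | v \in e]%SET|)%N.
    exact: leq_trans kd (min_degree_le v).
  have [Ss [sSs Ssbig hit]] :=
    robust_chords tree total E2 D2 comp degE kn Dsmall q0 h0 hk kh.
  apply: (@le_trans _ _ ((size Ss)%:R * k%:R^-1)); last first.
    by rewrite ler_wpM2r ?invr_ge0 ?ler0n // ler_nat.
  apply: le_trans (cond_prob_union p01 YD DE (del := k%:R^-1) _); last first.
    move=> S /Ssbig[SED Sk]; split=> //.
    rewrite -[leRHS]mul1r ler_pdivlMr //.
    apply: le_trans (expr1B_le #|S| p01); rewrite ler_wpM2l ?exprn_ge0 //; first by lra.
    (* From [k * k <= #|S| * q ^ 5] and [q ^ 5 <= c] follows [#|S| * p >= k]. *)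
    apply: (@le_trans _ _ (#|S|%:R * p)); last by lra.
    rewrite /p mulrA ler_pdivlMr // -natrM.
    apply: (@le_trans _ _ (#|S|%:R * (q ^ 5)%:R)); first by rewrite -natrM ler_nat.
    by rewrite ler_wpM2l ?ler0n.
  apply: (@cond_prob_le _ _ _ _ p01) => F YF; apply: contraR => /hasPn Shit.
  have [s [cs ks]] := hit F YF Shit.
  apply/mem_set; exists s; split=> //.
  rewrite mulrBl mul1r lerBlDr -mulrAC.
  apply: (@le_trans _ _ ((size s)%:R + (10 * (2 * h))%:R)); first by rewrite -natrD ler_nat.
  rewrite lerD2l ler_pdivlMr // natrM -mulrA ler_wpM2l // -natrM ler_nat mulnC; exact: hk.
(* After a long search the potential alone exceeds the trivial bound 1: [a ^+ #|D| >= 4 ^ n], while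
   [K] and [b ^+ #|Y|] are each at least [2 ^ (-n)]. *)
apply: (@le_trans _ _ 1).
  by rewrite -(cond_prob_setT p YD DE); apply: cond_prob_le.
apply: (@le_trans _ _ (2^-1 ^+ n * (a ^+ #|D| * 2^-1 ^+ #|Y|))); last first.
  by rewrite lerDr mulr_ge0 // invr_ge0.
have [t [t_ge Dt]] := query_budget q50 qk Dlarge.
have a1 : 1 + p / 2 <= a.
  by rewrite /a -[leRHS]mul1r ler_pdivlMr //; nra.
have at2 : 2 <= a ^+ t.
  apply: (@le_trans _ _ ((1 + p / 2) ^+ t)); last by apply: lerXn2r a1; rewrite ?nnegrE; lra.
  apply: (@le_trans _ _ (1 + t%:R * (p / 2))); last first.
    elim: (t) => [|i IH]; first by rewrite mul0r addr0 expr0.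
    rewrite exprSr; apply: le_trans (ler_wpM2r _ IH); last by lra.
    rewrite -natr1; have : 0 <= i%:R * (p / 2) by rewrite mulr_ge0 //; lra.
    by move: (i%:R : R) => x; nra.
  suff : 2 <= t%:R * p by lra.
  rewrite /p mulrA ler_pdivlMr // -natrM.
  apply: (@le_trans _ _ (t%:R * (q ^ 5)%:R)); first by rewrite -natrM ler_nat.
  by rewrite ler_wpM2l ?ler0n.
have aD : 2 ^+ (2 * n) <= a ^+ #|D|.
  apply: (@le_trans _ _ (a ^+ (t * (2 * n)))).
    by rewrite [a ^+ (_ * _)]exprM lerXn2r // ?nnegrE ?exprn_ge0 // ltW.
  by apply: ler_weXn2l Dt; lra.
have bY : 2^-1 ^+ n <= 2^-1 ^+ #|Y| :> R.
  by rewrite !exprVn lef_pV2 ?posrE ?exprn_gt0 // ler_weXn2l // ler1n.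
rewrite mulrCA.
apply: le_trans (ler_pM _ _ aD (ler_wpM2l _ bY)); rewrite ?mulr_ge0 ?exprn_ge0 //.
by rewrite mul2n -addnn exprD !exprVn mulrACA !mulfV ?mulr1 // expf_neq0.
Qed.

End LongCycle.

(** * Complete graphs *)

Definition pairs (n : nat) : {set {set 'I_n}} := [set e : {set 'I_n} | #|e| == 2%N]%SET.

Lemma card_pairs (n : nat) (e : {set 'I_n}) : e \in pairs n -> #|e| = 2%N.
Proof. by rewrite inE => /eqP. Qed.

Definition complete_graph (n : nat) : sgraph := SGraph (@card_pairs n).

Lemma min_degree_complete (k : nat) : (k <= min_degree (complete_graph k.+1))%N.
Proof.
apply: (big_ind (fun i => k <= i)%N) => [|x y kx ky|v _].
- by rewrite card_ord.
- by rewrite leq_min kx.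
have nbrs : #|[set [set v; w]%SET | w in [set~ v]%SET]%SET| = k.
  rewrite card_in_imset ?cardsC1 ?card_ord // => u w; rewrite !in_setC1 => uv _ /setP/(_ u).
  by rewrite !inE eqxx orbT (negbTE uv) /= => /esym/eqP.
rewrite -[leqLHS]nbrs; apply: subset_leq_card; apply/fintype.subsetP => e /imsetP[w]; rewrite in_setC1 => wv ->.
by rewrite !inE eqxx andbT cards2 (eq_sym v) wv.
Qed.

(** * Upper and lower bounds on [beta'] *)

Section Main.
Variable R : realType.

(** A cycle on at most [k + 1] vertices is shorter than [b * k] once [k > 1 / (b - 1)], so for
    [b > 1] the probability is eventually 0. *)
Lemma beta'_le1 (c : R) : (beta' c <= 1)%E.
Proof.
apply: (@le_trans _ _ (sup_cycle c (fun k => complete_graph k.+1))).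
  apply: ereal_inf_lbound; exists (fun k => complete_graph k.+1); split=> // k _.
  exact: min_degree_complete.
apply: ge_ereal_sup => _ [b [b0 aas] <-]; rewrite lee_fin leNgt; apply/negP => b1.
have half : (0 : R) < 2^-1 by rewrite invr_gt0.
have : \forall k \near \oo, False.
  move/cvgrPdist_lt/(_ _ half) : aas => aas.
  near=> k.
  have : `|1 - prob_subgraph (edge_prob c k) (has_cycle_ge (V := vertex (complete_graph k.+1)) (b * k%:R))| < 2^-1.
    by near: k; exact: aas.
  rewrite (_ : prob_subgraph _ _ = 0) ?subr0 ?normr1; first by lra.
  rewrite /prob_subgraph big_pred0 // => F; apply/negP => /andP[_ /set_mem[s [cs]]].
  apply/negP; rewrite -ltNge.
  have us : (size s <= k.+1)%N.
    have /and3P[_ _ us] := cs.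
    by rewrite -(card_uniqP us) -[leqRHS]card_ord max_card.
  apply: (@le_lt_trans _ _ k.+1%:R); first by rewrite ler_nat.
  rewrite -natr1; have : 1 / (b - 1) < k%:R by near: k; exact: nbhs_infty_gtr.
  by rewrite ltr_pdivrMr; lra.
by move/filter_ex => [].
Unshelve. all: end_near.
Qed.

(** Since [q] stays fixed as [k] grows, the failure bound [(4 * q + 1) / k] tends to 0, whatever the
    graphs. *)
Lemma beta'_ge (c : R) (q : nat) : (122 * 122 <= q)%N -> (q ^ 5)%:R <= c ->
  ((1 - 10 / q%:R)%:E <= beta' c)%E.
Proof.
move=> q0 qc; apply: le_ereal_inf_tmp => _ [G [dG ->]].
apply: ereal_sup_ubound; exists (1 - 10 / q%:R) => //; split.
  rewrite subr_ge0 ler_pdivrMr ?mul1r ?ler_nat; first exact: leq_trans q0.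
  by rewrite ltr0n; exact: leq_trans q0.
apply/cvgrPdist_le => e e0; near=> k.
have k0 : (0 < k)%N by near: k; exact: nbhs_infty_gt.
have ck : c <= k%:R by near: k; exact: nbhs_infty_ger.
have qk : (q ^ 5 <= k)%N by near: k; exact: nbhs_infty_ge.
have ke : (4 * q).+1%:R / e <= k%:R by near: k; exact: nbhs_infty_ger.
have c0 : 0 <= c by apply: le_trans qc; rewrite ler0n.
have k0R : 0 < k%:R :> R by rewrite ltr0n.
have ck1 : c / k%:R <= 1 by rewrite ler_pdivrMr // mul1r.
have -> : edge_prob c k = c / k%:R by rewrite /edge_prob min_l.
rewrite prob_subgraph_compl; last by rewrite ck1 divr_ge0 // ltW.
apply: le_trans (long_cycle_prob q0 qk qc ck (dG k k0)) _.
by rewrite ler_pdivrMr // mulrC -ler_pdivrMr.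
Unshelve. all: end_near.
Qed.

End Main.

Theorem theorem3 (R : realType) :
  exists C : R, \forall c \near +oo_R,
    (`|1 - beta' c| <= (C * c `^ (- (1 / 5)))%:E)%E.
Proof.
exists 20; near=> c.
have c0 : 0 < c by near: c; exact: nbhs_pinfty_gt.
have cbig : ((122 * 122).+1 ^ 5)%:R <= c by near: c; apply: nbhs_pinfty_ge; rewrite num_real.
set r := c `^ (1 / 5).
have r5 : r ^+ 5 = c.
  by rewrite -powR_mulrn ?powR_ge0 // -powRrM div1r mulVf ?powRr1 // ltW.
have r0 : 0 < r by rewrite powR_gt0.
have rbig : ((122 * 122).+1)%:R <= r.
  by rewrite -(@ler_pXn2r _ 5) ?nnegrE ?(ltW r0) ?ler0n // r5 -natrX.
(* Rounding down keeps [q ^ 5 <= c], and [r < q + 1 <= 2 * q] turns [10 / q] into [20 / r], whence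
   the constant 20. *)
pose q := Num.truncn r.
have /andP[qr rq] := truncn_itv (ltW r0).
rewrite -/q in qr rq.
have q0 : (122 * 122 <= q)%N.
  by rewrite -ltnS -(ltr_nat R); apply: le_lt_trans rq; apply: le_trans rbig; rewrite ler_nat.
have q0R : 0 < q%:R :> R by rewrite ltr0n; exact: leq_trans q0.
have lo : ((1 - 20 / r)%:E <= beta' c)%E.
  apply: (@le_trans _ _ (1 - 10 / q%:R)%:E); last first.
    by apply: beta'_ge => //; rewrite natrX -r5 lerXn2r // nnegrE ltW.
  rewrite lee_fin lerD2l lerN2 ler_pdivrMr // mulrAC ler_pdivlMr //.
  have : q.+1%:R <= 2 * q%:R :> R by rewrite -natrM ler_nat; lia.
  by move: rq; move: (q.+1%:R : R) => x; lra.
have hi := beta'_le1 c.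
rewrite powRN -/r; case: (beta' c) lo hi => [x||]; rewrite ?lee_fin // => lo hi.
by rewrite ger0_norm; lra.
Unshelve. all: end_near.
Qed.
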